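(* Let $\mathcal{L}^L$ be the free monoidal category with a family of left monoidal endofunctors $\{E^i\mid i\in\mathcal{I}\}$ generated by a set of generating objects. Then the functor $G$ from $\mathcal{L}^L$ to the category $\mathit{Fun}$ of functions between finite ordinals is faithful; equivalently (since $G$ sends every arrow to an identity function), $\mathcal{L}^L$ is a preorder, i.e. any two arrows $f,g:A\to B$ of $\mathcal{L}^L$ with the same source and target are equal.
   Context: A monoidal category is a category with a bifunctor $\otimes$, a unit object $I$, and natural isomorphisms with components $a_{A,B,C}:(A\otimes B)\otimes C\to A\otimes(B\otimes C)$, $l_A:I\otimes A\to A$, $r_A:A\otimes I\to A$, satisfying Mac Lane's coherence equations (pentagon and triangle). A left monoidal endofunctor of a monoidal category is an endofunctor $E$ together with a natural transformation $\psi^L_{A,B}:EA\otimes B\to E(A\otimes B)$ such that (1) $Ea_{A,B,C}\circ\psi^L_{A\otimes B,C}\circ(\psi^L_{A,B}\otimes\mathbf{1}_C)=\psi^L_{A,B\otimes C}\circ a_{EA,B,C}$; (2) $Er_A\circ\psi^L_{A,I}=r_{EA}$. The category $\mathcal{L}^L$: fix two arbitrary sets, one of generating objects (propositional letters) and one of generating functors $\{E^i\mid i\in\mathcal{I}\}$. Objects are the formulae built from the letters and the constant $I$ with the binary connective $\otimes$ and the unary connectives $E^i$. Arrows are equivalence classes of arrow terms built from $\mathbf{1}_A$, $a_{A,B,C}$, $l_A$, $r_A$, the inverses of $a,l,r$, and $\psi^{L,i}_{A,B}$ (for each $i\in\mathcal{I}$) with the operations $\circ$, $\otimes$ and $E^i$,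 modulo the smallest congruence for which the equations of monoidal categories hold and each $(E^i,\psi^{L,i})$ is a left monoidal endofunctor. Superscripts $i$ are omitted below. The functor $G$: $\mathit{Fun}$ has as objects the finite ordinals $n=\{0,\dots,n-1\}$ and as arrows all functions. $GA$ is the number of occurrences of the generating functors $E^i$ (for all $i$ together) in $A$. $G$ of $\mathbf{1}$, $a$, $l$, $r$ (and inverses) and of $\psi^L_{A,B}$ is an identity function; $G(f\otimes g)$ is $Gf$ and $Gg$ placed side by side (disjoint sum); $GEf$ maps $0\mapsto 0$ and $1+k\mapsto 1+(Gf)(k)$; $G(g\circ f)=Gg\circ Gf$. *)

(* Defs.v *)
From mathcomp Require Import all_boot.

Set Implicit Arguments.
Unset Strict Implicit.
Unset Printing Implicit Defensive.

(* Arrows of a category are taken up to an explicit equivalence relation     *)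
(* [heq]: a quotient of a type of arrow terms is that type with [heq] the    *)
(* congruence, and equality of arrows is [heq].  [ccomp g f] is g after f.   *)
Record category := Category {
  ob :> Type;
  hom : ob -> ob -> Type;
  heq : forall A B, hom A B -> hom A B -> Prop;
  cid : forall A, hom A A;
  ccomp : forall A B C, hom B C -> hom A B -> hom A C;
  heq_refl : forall A B (f : hom A B), heq f f;
  heq_sym : forall A B (f g : hom A B), heq f g -> heq g f;
  heq_trans : forall A B (f g h : hom A B), heq f g -> heq g h -> heq f h;
  ccomp_heq : forall A B C (g g' : hom B C) (f f' : hom A B),
    heq g g' -> heq f f' -> heq (ccomp g f) (ccomp g' f');
  ccomp1l : forall A B (f : hom A B), heq (ccomp (cid B) f) f;
  ccomp1r : forall A B (f : hom A B), heq (ccomp f (cid A)) f;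
  ccompA : forall A B C D (h : hom C D) (g : hom B C) (f : hom A B),
    heq (ccomp (ccomp h g) f) (ccomp h (ccomp g f))
}.

Record functor (C D : category) := Functor {
  fob :> C -> D;
  fhom : forall A B : C, hom A B -> hom (fob A) (fob B);
  fhom_heq : forall (A B : C) (f g : hom A B), heq f g -> heq (fhom f) (fhom g);
  fhom_id : forall A : C, heq (fhom (cid A)) (cid (fob A));
  fhom_comp : forall (A B E : C) (g : hom B E) (f : hom A B),
    heq (fhom (ccomp g f)) (ccomp (fhom g) (fhom f))
}.

Definition faithful (C D : category) (F : functor C D) : Prop :=
  forall (A B : C) (f g : hom A B), heq (fhom F f) (fhom F g) -> heq f g.

Definition preorder (C : category) : Prop :=
  forall (A B : C) (f g : hom A B), heq f g.

Definition fun_id (n : nat) : {ffun 'I_n -> 'I_n} := [ffun i => i].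

Definition fun_comp (m n p : nat)
    (v : {ffun 'I_n -> 'I_p}) (u : {ffun 'I_m -> 'I_n}) : {ffun 'I_m -> 'I_p} :=
  [ffun i => v (u i)].

Definition Fun : category.
Proof.
apply: (@Category nat (fun m n => {ffun 'I_m -> 'I_n})
                  (fun m n u v => u = v) fun_id fun_comp) => //.
- by move=> m n u v w -> ->.
- by move=> m n p v v' u u' -> ->.
- by move=> m n u; apply/ffunP => i; rewrite !ffunE.
- by move=> m n u; apply/ffunP => i; rewrite !ffunE.
- by move=> m n p q w v u; apply/ffunP => i; rewrite !ffunE.
Defined.

(* Identity functions between ordinals that are equal only propositionally,  *)
(* such as (m + n) + p and m + (n + p).                                      *)
Definition fun_cast (m n : nat) (e : m = n) : {ffun 'I_m -> 'I_n} :=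
  [ffun i => cast_ord e i].

Definition is_identity (m n : nat) (u : {ffun 'I_m -> 'I_n}) : Prop :=
  exists e : m = n, u = fun_cast e.

Definition fun_sum (m n p q : nat)
    (u : {ffun 'I_m -> 'I_n}) (v : {ffun 'I_p -> 'I_q}) :
    {ffun 'I_(m + p) -> 'I_(n + q)} :=
  [ffun i => match split i with
             | inl j => lshift q (u j)
             | inr k => rshift n (v k)
             end].

Definition fun_succ (m n : nat) (u : {ffun 'I_m -> 'I_n}) :
    {ffun 'I_m.+1 -> 'I_n.+1} :=
  [ffun i => if unlift ord0 i is Some k then lift ord0 (u k) else ord0].

(* [P] is the set of letters, [J] the set indexing the generating functors.  *)
Inductive formula (P J : Type) : Type :=
| letter of P
| unit_obj
| tensor of formula P J & formula P J
| endo of J & formula P J.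

Arguments letter {P J} _.
Arguments unit_obj {P J}.

Declare Scope formula_scope.
Delimit Scope formula_scope with form.
Bind Scope formula_scope with formula.
Notation "A ⊗ B" := (tensor A B)
  (at level 40, left associativity) : formula_scope.

Section FreeCategory.

Variables P J : Type.
Implicit Types (i : J) (A B C D : formula P J).
Local Open Scope formula_scope.

Inductive term : formula P J -> formula P J -> Type :=
| t_id A : term A A
| t_comp A B C : term B C -> term A B -> term A C
| t_tensor A B C D : term A B -> term C D -> term (A ⊗ C) (B ⊗ D)
| t_endo i A B : term A B -> term (endo i A) (endo i B)
| t_a A B C : term (A ⊗ B ⊗ C) (A ⊗ (B ⊗ C))
| t_aV A B C : term (A ⊗ (B ⊗ C)) (A ⊗ B ⊗ C)
| t_l A : term (unit_obj ⊗ A) A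
| t_lV A : term A (unit_obj ⊗ A)
| t_r A : term (A ⊗ unit_obj) A
| t_rV A : term A (A ⊗ unit_obj)
| t_psi i A B : term (endo i A ⊗ B) (endo i (A ⊗ B)).

Local Notation "g ∘ f" := (t_comp g f) (at level 50, left associativity).
Local Notation "f ⊠ g" := (t_tensor f g) (at level 40, left associativity).
Reserved Notation "f ≈ g" (at level 70, no associativity).

Inductive cong : forall A B, term A B -> term A B -> Prop :=
| cong_refl A B (f : term A B) : f ≈ f
| cong_sym A B (f g : term A B) : f ≈ g -> g ≈ f
| cong_trans A B (f g h : term A B) : f ≈ g -> g ≈ h -> f ≈ h
| cong_comp A B C (g g' : term B C) (f f' : term A B) :
    g ≈ g' -> f ≈ f' -> g ∘ f ≈ g' ∘ f'
| cong_tensor A B C D (f f' : term A B) (g g' : term C D) :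
    f ≈ f' -> g ≈ g' -> f ⊠ g ≈ f' ⊠ g'
| cong_endo i A B (f f' : term A B) :
    f ≈ f' -> t_endo i f ≈ t_endo i f'
| cong_id_l A B (f : term A B) : t_id B ∘ f ≈ f
| cong_id_r A B (f : term A B) : f ∘ t_id A ≈ f
| cong_assoc A B C D (h : term C D) (g : term B C) (f : term A B) :
    (h ∘ g) ∘ f ≈ h ∘ (g ∘ f)
| cong_tensor_id A B : t_id A ⊠ t_id B ≈ t_id (A ⊗ B)
| cong_tensor_comp A B C A' B' C' (g : term B C) (f : term A B)
    (g' : term B' C') (f' : term A' B') :
    (g ∘ f) ⊠ (g' ∘ f') ≈ (g ⊠ g') ∘ (f ⊠ f')
| cong_a_nat A B C A' B' C' (f : term A A') (g : term B B') (h : term C C') :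
    t_a A' B' C' ∘ ((f ⊠ g) ⊠ h) ≈ (f ⊠ (g ⊠ h)) ∘ t_a A B C
| cong_l_nat A A' (f : term A A') :
    t_l A' ∘ (t_id unit_obj ⊠ f) ≈ f ∘ t_l A
| cong_r_nat A A' (f : term A A') :
    t_r A' ∘ (f ⊠ t_id unit_obj) ≈ f ∘ t_r A
| cong_a_aV A B C : t_a A B C ∘ t_aV A B C ≈ t_id (A ⊗ (B ⊗ C))
| cong_aV_a A B C : t_aV A B C ∘ t_a A B C ≈ t_id (A ⊗ B ⊗ C)
| cong_l_lV A : t_l A ∘ t_lV A ≈ t_id A
| cong_lV_l A : t_lV A ∘ t_l A ≈ t_id (unit_obj ⊗ A)
| cong_r_rV A : t_r A ∘ t_rV A ≈ t_id A
| cong_rV_r A : t_rV A ∘ t_r A ≈ t_id (A ⊗ unit_obj)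
| cong_pentagon A B C D :
    t_a A B (C ⊗ D) ∘ t_a (A ⊗ B) C D
    ≈ (t_id A ⊠ t_a B C D) ∘ t_a A (B ⊗ C) D ∘ (t_a A B C ⊠ t_id D)
| cong_triangle A B :
    (t_id A ⊠ t_l B) ∘ t_a A unit_obj B ≈ t_r A ⊠ t_id B
| cong_endo_id i A : t_endo i (t_id A) ≈ t_id (endo i A)
| cong_endo_comp i A B C (g : term B C) (f : term A B) :
    t_endo i (g ∘ f) ≈ t_endo i g ∘ t_endo i f
| cong_psi_nat i A B A' B' (f : term A A') (g : term B B') :
    t_psi i A' B' ∘ (t_endo i f ⊠ g) ≈ t_endo i (f ⊠ g) ∘ t_psi i A B
| cong_psi_a i A B C :
    t_endo i (t_a A B C) ∘ t_psi i (A ⊗ B) C ∘ (t_psi i A B ⊠ t_id C)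
    ≈ t_psi i A (B ⊗ C) ∘ t_a (endo i A) B C
| cong_psi_r i A :
    t_endo i (t_r A) ∘ t_psi i A unit_obj ≈ t_r (endo i A)
where "f ≈ g" := (cong f g).

Definition LL : category :=
  @Category (formula P J) term cong t_id t_comp cong_refl cong_sym cong_trans
    cong_comp cong_id_l cong_id_r cong_assoc.

Fixpoint occ A : nat :=
  match A with
  | letter _ => 0
  | unit_obj => 0
  | A1 ⊗ A2 => occ A1 + occ A2
  | endo _ A1 => (occ A1).+1
  end.

Fixpoint G_term A B (f : term A B) : {ffun 'I_(occ A) -> 'I_(occ B)} :=
  match f in term A B return {ffun 'I_(occ A) -> 'I_(occ B)} with
  | t_id A => fun_id (occ A)
  | t_comp _ _ _ g f => fun_comp (G_term g) (G_term f)
  | t_tensor _ _ _ _ f g => fun_sum (G_term f) (G_term g)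
  | t_endo _ _ _ f => fun_succ (G_term f)
  | t_a A B C => fun_cast (esym (addnA (occ A) (occ B) (occ C)))
  | t_aV A B C => fun_cast (addnA (occ A) (occ B) (occ C))
  | t_l A => fun_cast (add0n (occ A))
  | t_lV A => fun_cast (esym (add0n (occ A)))
  | t_r A => fun_cast (addn0 (occ A))
  | t_rV A => fun_cast (esym (addn0 (occ A)))
  | t_psi _ A B => fun_cast (addSn (occ A) (occ B))
  end.

Lemma occ_eq A B (f : term A B) : occ A = occ B.
Proof.
elim: f => //=.
- by move=> ? ? ? _ IHg _ IHf; rewrite IHf.
- by move=> ? ? ? ? _ -> _ ->.
- by move=> _ ? ? _ ->.
- by move=> ? ? ?; rewrite addnA.
- by move=> ? ? ?; rewrite addnA.
- by move=> ?; rewrite addn0.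
- by move=> ?; rewrite addn0.
Qed.

Lemma G_term_val A B (f : term A B) (k : 'I_(occ A)) : G_term f k = k :> nat.
Proof.
elim: f k => /=; try by move=> *; rewrite ffunE.
- by move=> ? ? ? g IHg f IHf k; rewrite ffunE IHg IHf.
- move=> A1 B1 C1 D1 f IHf g IHg k; rewrite ffunE.
  by case: splitP => j -> /=; rewrite ?IHf ?IHg ?(occ_eq f).
- move=> _ ? ? f IHf k; rewrite ffunE.
  by case: unliftP => [j ->|->] //=; rewrite IHf.
Qed.

Lemma G_term_cong A B (f g : term A B) : cong f g -> G_term f = G_term g.
Proof. by move=> _; apply/ffunP => k; apply: val_inj; rewrite /= !G_term_val. Qed.

Definition G : functor LL Fun :=
  @Functor LL Fun occ G_term G_term_cong
    (fun _ => erefl) (fun _ _ _ _ _ => erefl).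

End FreeCategory.

(* Main.v *)
From Stdlib Require Import Setoid Morphisms Eqdep.
Require Import Defs.
From mathcomp Require Import all_boot.

Set Implicit Arguments.
Unset Strict Implicit.
Unset Printing Implicit Defensive.

(** Up to the monoidal isomorphisms an object is a forest: a list of trees whose
    leaves are letters and whose inner nodes are occurrences of the functors.
    An arrow keeps the order of the letters and nodes, and each node may only
    absorb, as new last children, trees that stand just to its right.  Hence an
    arrow is determined by its source and target, once it is shown to be equal
    to a composite that reads these absorptions off the target.

    The first ingredient is coherence for the terms without psi
    ([psi_free_unique], [flat_psi_free]): there is such a term from A to B
    exactly when A and B have the same forest, and then only one.  It is proved
    by normalization: [norm A X] sends the tensor of A and a forest X to the
    forest of the tensor, and psi-free terms commute with it.

    The second is a pair of factorizations of an arbitrary arrow f, proved by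
    induction on f.  If the target is a tensor of C and D, then f is, up to a
    psi-free term, a tensor of an arrow to C and an arrow to D ([all_splits]).
    If the target is the tensor of E A and C, then the source is, up to a
    psi-free term, the tensor of E A', L and R, and f first lets E A' absorb L
    by one psi and then applies E of an arrow to A and an arrow to C
    ([all_absorbs]).  In this second factorization composites need the axiom
    that relates psi to associativity ([shift_shift]), and psi-free arrows need
    the one that relates psi to r.

    For a target that is a forest, [emb_unique] then follows by induction on the
    forest.  Two factorizations of parallel arrows through E A', L, R and
    E A'', L', R' have the same forests: arrows preserve the number of letters
    and nodes, so R and R' have the size of C, and a suffix of a forest is
    determined by its size.  The psi-free part of one is therefore that of the
    other followed by psi-free comparison terms, which naturality of psi moves
    into the smaller arrows, where induction applies. *)

Section Coherence.

Variables P J : Type.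
Local Notation fm := (formula P J).
Implicit Types (i : J) (A B C D : fm).
Local Open Scope formula_scope.

Local Notation "g ∘ f" := (t_comp g f) (at level 50, left associativity).
Local Notation "f ⊠ g" := (t_tensor f g) (at level 40, left associativity).
Local Notation "f ≈ g" := (cong f g) (at level 70, no associativity).
Local Notation "'𝟏'" := (t_id _).
Local Notation II := (@unit_obj P J).

(** * Calculus of arrow terms *)

#[local] Hint Resolve cong_refl : core.

#[local] Instance cong_Equivalence A B : Equivalence (@cong P J A B).
Proof.
split; [exact: cong_refl | exact: cong_sym | exact: cong_trans].
Qed.

#[local] Instance t_comp_Proper A B C :
  Proper (@cong P J B C ==> @cong P J A B ==> @cong P J A C) (@t_comp P J A B C).
Proof. by move=> g g' Hg f f' Hf; apply: cong_comp. Qed.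

#[local] Instance t_tensor_Proper A B C D :
  Proper (@cong P J A B ==> @cong P J C D ==> @cong P J (A ⊗ C) (B ⊗ D))
    (@t_tensor P J A B C D).
Proof. by move=> f f' Hf g g' Hg; apply: cong_tensor. Qed.

#[local] Instance t_endo_Proper i A B :
  Proper (@cong P J A B ==> @cong P J (endo i A) (endo i B)) (@t_endo P J i A B).
Proof. by move=> f f' Hf; apply: cong_endo. Qed.

Lemma comp_reassoc A B C D (h : term C D) (g : term B C) (k : term B D)
    (f : term A B) :
  h ∘ g ≈ k -> h ∘ (g ∘ f) ≈ k ∘ f.
Proof. by move=> e; rewrite -e cong_assoc. Qed.

Lemma tensor_merge A B C A' B' C' (g : term B C) (f : term A B)
    (g' : term B' C') (f' : term A' B') :
  (g ⊠ g') ∘ (f ⊠ f') ≈ (g ∘ f) ⊠ (g' ∘ f').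
Proof. by rewrite cong_tensor_comp. Qed.

Lemma tensor_merge_comp A B C A' B' C' D (g : term B C) (f : term A B)
    (g' : term B' C') (f' : term A' B') (h : term D (A ⊗ A')) :
  (g ⊠ g') ∘ ((f ⊠ f') ∘ h) ≈ ((g ∘ f) ⊠ (g' ∘ f')) ∘ h.
Proof. by rewrite -cong_assoc tensor_merge. Qed.

Lemma endo_merge i A B C (g : term B C) (f : term A B) :
  t_endo i g ∘ t_endo i f ≈ t_endo i (g ∘ f).
Proof. by rewrite cong_endo_comp. Qed.

Lemma comp_cancel_r A B C (g g' : term B C) (f : term A B) (fV : term B A) :
  f ∘ fV ≈ 𝟏 -> g ∘ f ≈ g' ∘ f -> g ≈ g'.
Proof.
move=> e /(fun h => cong_comp h (cong_refl fV)).
by rewrite !cong_assoc e !cong_id_r.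
Qed.

Lemma comp_cancel_l A B C (g g' : term A B) (f : term B C) (fV : term C B) :
  fV ∘ f ≈ 𝟏 -> f ∘ g ≈ f ∘ g' -> g ≈ g'.
Proof.
move=> e /(cong_comp (cong_refl fV)).
by rewrite -!cong_assoc e !cong_id_l.
Qed.

Lemma aV_nat A B C A' B' C' (f : term A A') (g : term B B') (h : term C C') :
  t_aV A' B' C' ∘ (f ⊠ (g ⊠ h)) ≈ (f ⊠ g ⊠ h) ∘ t_aV A B C.
Proof.
apply: (comp_cancel_l (cong_aV_a _ _ _)).
by rewrite -!cong_assoc cong_a_aV cong_id_l cong_a_nat cong_assoc cong_a_aV cong_id_r.
Qed.

Lemma lV_nat A A' (f : term A A') : t_lV A' ∘ f ≈ (𝟏 ⊠ f) ∘ t_lV A.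
Proof.
apply: (comp_cancel_l (cong_lV_l _)).
by rewrite -!cong_assoc cong_l_lV cong_id_l cong_l_nat cong_assoc cong_l_lV cong_id_r.
Qed.

Lemma rV_nat A A' (f : term A A') : t_rV A' ∘ f ≈ (f ⊠ 𝟏) ∘ t_rV A.
Proof.
apply: (comp_cancel_l (cong_rV_r _)).
by rewrite -!cong_assoc cong_r_rV cong_id_l cong_r_nat cong_assoc cong_r_rV cong_id_r.
Qed.

Lemma unit_tensor_faithful A B (f g : term A B) :
  t_id II ⊠ f ≈ t_id II ⊠ g -> f ≈ g.
Proof.
move=> h; apply: (comp_cancel_r (cong_l_lV A)).
by rewrite -!cong_l_nat h.
Qed.

(** A theorem of Kelly.  Tensoring with the unit on the left is faithful, and
    after it both sides are compared by the pentagon whose second object is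
    the unit, with two triangles. *)
Lemma l_tensor A B : t_l (A ⊗ B) ∘ t_a II A B ≈ t_l A ⊠ t_id B.
Proof.
apply: unit_tensor_faithful.
have aaV : t_a II (II ⊗ A) B ∘ (t_a II II A ⊠ t_id B) ∘
    ((t_aV II II A ⊠ t_id B) ∘ t_aV II (II ⊗ A) B) ≈ 𝟏.
  rewrite !cong_assoc (comp_reassoc _ (tensor_merge _ _ _ _)).
  by rewrite cong_a_aV cong_id_l cong_tensor_id cong_id_l cong_a_aV.
apply: (comp_cancel_r aaV).
have -> : (t_id II ⊠ (t_l (A ⊗ B) ∘ t_a II A B)) ∘
    (t_a II (II ⊗ A) B ∘ (t_a II II A ⊠ t_id B)) ≈
    (𝟏 ⊠ t_l (A ⊗ B)) ∘ ((𝟏 ⊠ t_a II A B) ∘ t_a II (II ⊗ A) B ∘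
      (t_a II II A ⊠ t_id B)).
  by rewrite -!cong_assoc tensor_merge cong_id_l.
rewrite -cong_pentagon -cong_assoc cong_triangle -cong_tensor_id -cong_a_nat.
rewrite -cong_triangle -!cong_assoc -cong_a_nat !cong_assoc.
by rewrite tensor_merge cong_id_l.
Qed.

(** * Coherence of the terms without psi *)

Fixpoint psi_free A B (f : term A B) : bool :=
  match f with
  | t_comp _ _ _ g f => psi_free g && psi_free f
  | t_tensor _ _ _ _ f g => psi_free f && psi_free g
  | t_endo _ _ _ f => psi_free f
  | t_psi _ _ _ => false
  | _ => true
  end.

Lemma psi_free_inv A B (f : term A B) : psi_free f ->
  exists g : term B A, [/\ psi_free g, g ∘ f ≈ 𝟏 & f ∘ g ≈ 𝟏].
Proof.
elim: f => /=.
- by move=> C _; exists 𝟏; split; rewrite ?cong_id_l.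
- move=> C D E g IHg f IHf /andP[/IHg[gV [pg g1 g2]] /IHf[fV [pf f1 f2]]].
  exists (fV ∘ gV); split; first by rewrite /= pf.
  + by rewrite cong_assoc (comp_reassoc _ g1) cong_id_l.
  + by rewrite cong_assoc (comp_reassoc _ f2) cong_id_l.
- move=> C D C' D' g IHg f IHf /andP[/IHg[gV [pg g1 g2]] /IHf[fV [pf f1 f2]]].
  exists (gV ⊠ fV); split; first by rewrite /= pg.
  + by rewrite tensor_merge g1 f1 cong_tensor_id.
  + by rewrite tensor_merge g2 f2 cong_tensor_id.
- move=> i C D f IHf /IHf[fV [pf f1 f2]].
  exists (t_endo i fV); split => //.
  + by rewrite endo_merge f1 cong_endo_id.
  + by rewrite endo_merge f2 cong_endo_id.
- move=> C D E _; exists (t_aV C D E); split => //; [exact: cong_aV_a|exact: cong_a_aV].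
- move=> C D E _; exists (t_a C D E); split => //; [exact: cong_a_aV|exact: cong_aV_a].
- move=> C _; exists (t_lV C); split => //; [exact: cong_lV_l|exact: cong_l_lV].
- move=> C _; exists (t_l C); split => //; [exact: cong_l_lV|exact: cong_lV_l].
- move=> C _; exists (t_rV C); split => //; [exact: cong_rV_r|exact: cong_r_rV].
- move=> C _; exists (t_r C); split => //; [exact: cong_r_rV|exact: cong_rV_r].
- by [].
Qed.

(** A list of trees, with the nested recursion of trees and lists flattened:
    [fnode i X Y] has the tree with root i and children X in front of Y. *)
Inductive forest : Type :=
| fnil
| fletter of P & forest
| fnode of J & forest & forest.
Implicit Types X Y Z : forest.

Fixpoint emb X : fm :=
  match X with
  | fnil => II
  | fletter p X => letter p ⊗ emb X
  | fnode i X Y => endo i (emb X) ⊗ emb Y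
  end.

(** The accumulator X makes the two bracketings of a triple tensor, and A with
    or without a unit factor, have convertible normal forms, so that a, l and r
    need no cast. *)
Fixpoint nf A X : forest :=
  match A with
  | letter p => fletter p X
  | unit_obj => X
  | A1 ⊗ A2 => nf A1 (nf A2 X)
  | endo i A1 => fnode i (nf A1 fnil) X
  end.

Fixpoint norm A X : term (A ⊗ emb X) (emb (nf A X)) :=
  match A with
  | letter _ => 𝟏
  | unit_obj => t_l _
  | A1 ⊗ A2 => norm A1 (nf A2 X) ∘ (𝟏 ⊠ norm A2 X) ∘ t_a _ _ _
  | endo i A1 => t_endo i (norm A1 fnil ∘ t_rV A1) ⊠ 𝟏
  end.

Lemma norm_psi_free A X : psi_free (norm A X).
Proof.
elim: A X => [p||A IHA B IHB|i A IHA] X //=; first by rewrite IHA IHB.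
by rewrite (IHA fnil).
Qed.

Definition fcast X Y (e : X = Y) : term (emb X) (emb Y) :=
  match e with erefl => 𝟏 end.

(** Uniqueness of identity proofs is what excludes that a psi-free loop acts on
    a normal form by a nontrivial cast: letters and indices need not have
    decidable equality. *)
Lemma fcast1 X (e : X = X) : fcast e = 𝟏.
Proof. by rewrite (UIP _ _ _ e erefl). Qed.

Lemma fcast_psi_free X Y (e : X = Y) : psi_free (fcast e).
Proof. by case: Y / e. Qed.

Lemma norm_fcast A X Y (e : X = Y) (e' : nf A X = nf A Y) :
  norm A Y ∘ (𝟏 ⊠ fcast e) ≈ fcast e' ∘ norm A X.
Proof.
case: Y / e e' => e'.
by rewrite !fcast1 cong_tensor_id cong_id_l cong_id_r.
Qed.

Lemma fcast_comp X Y Z (e1 : X = Y) (e2 : Y = Z) (e : X = Z) :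
  fcast e2 ∘ fcast e1 ≈ fcast e.
Proof. by case: Z / e2 e => e; case: Y / e1 e => e; rewrite !fcast1 cong_id_l. Qed.

Lemma fcast_fnode i X Y Z (e : X = Y) (e' : fnode i X Z = fnode i Y Z) :
  t_endo i (fcast e) ⊠ 𝟏 ≈ fcast e'.
Proof.
by case: Y / e e' => e'; rewrite !fcast1 cong_endo_id cong_tensor_id.
Qed.

Lemma nf_psi_free A B (f : term A B) : psi_free f -> forall X, nf A X = nf B X.
Proof.
elim: f => //=.
- by move=> C D E g IHg f IHf /andP[/IHg eg /IHf ef] X; rewrite ef.
- by move=> C D C' D' g IHg f IHf /andP[/IHg eg /IHf ef] X; rewrite ef eg.
- by move=> i C D f IHf /IHf ef X; rewrite ef.
Qed.

Definition norm_compat A B (f : term A B) : Prop :=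
  forall X (e : nf A X = nf B X),
    norm B X ∘ (f ⊠ 𝟏) ≈ fcast e ∘ norm A X.

(** Passing to inverses spares a separate argument for each of the inverse
    constants. *)
Lemma norm_compat_inv A B (f : term A B) (g : term B A) :
  (forall X, nf A X = nf B X) ->
  f ∘ g ≈ 𝟏 -> norm_compat f -> norm_compat g.
Proof.
move=> ef fg cf X e.
have h : fcast (ef X) ∘ (norm A X ∘ (g ⊠ 𝟏)) ≈ norm B X.
  by rewrite -cong_assoc -cf cong_assoc tensor_merge fg cong_id_l cong_tensor_id cong_id_r.
have [k [_ k1 _]] := psi_free_inv (fcast_psi_free (ef X)).
apply: (comp_cancel_l k1); rewrite h -cong_assoc (fcast_comp _ _ erefl) /=.
by rewrite cong_id_l.
Qed.

(** The constant a is the pentagon, r the triangle and l the lemma of Kelly. *)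
Lemma psi_free_norm_compat A B (f : term A B) : psi_free f -> norm_compat f.
Proof.
have ca C D E : norm_compat (t_a C D E).
  move=> X e; rewrite fcast1 cong_id_l /=.
  (* The pentagon, with its sides already reassociated to the right. *)
  have h : t_a C D (E ⊗ emb X) ∘ t_a (C ⊗ D) E (emb X) ≈ _ :=
    cong_pentagon C D E (emb X).
  rewrite !cong_assoc in h *.
  rewrite -{1}cong_tensor_id (comp_reassoc _ (cong_a_nat _ _ _)) cong_assoc h.
  rewrite 2!tensor_merge_comp !cong_id_l.
  by rewrite -!cong_assoc.
have cl C : norm_compat (t_l C).
  by move=> X e; rewrite fcast1 cong_id_l /= -l_tensor -!cong_assoc cong_l_nat.
have cr C : norm_compat (t_r C).
  by move=> X e; rewrite fcast1 cong_id_l /= !cong_assoc cong_triangle.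
elim: f => //=.
- by move=> C _ X e; rewrite fcast1 cong_tensor_id cong_id_l cong_id_r.
- move=> C D E g IHg f IHf /andP[pg pf] X e.
  have eg := nf_psi_free pg X; have ef := nf_psi_free pf X.
  have -> : (g ∘ f) ⊠ t_id (emb X) ≈ (g ⊠ 𝟏) ∘ (f ⊠ 𝟏).
    by rewrite tensor_merge cong_id_l.
  by rewrite -cong_assoc (IHg pg X eg) cong_assoc (IHf pf X ef) -cong_assoc fcast_comp.
- move=> A1 B1 C D f IHf g IHg /andP[pf pg] X e /=.
  have eg := nf_psi_free pg X.
  have ef := nf_psi_free pf (nf C X).
  rewrite !cong_assoc cong_a_nat tensor_merge_comp cong_id_l (IHg pg X eg).
  have -> : f ⊠ (fcast eg ∘ norm C X) ≈
      (𝟏 ⊠ fcast eg) ∘ ((f ⊠ 𝟏) ∘ (𝟏 ⊠ norm C X)).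
    by rewrite !tensor_merge !cong_id_l cong_id_r.
  rewrite -!cong_assoc (norm_fcast _ (f_equal (nf B1) eg)).
  by rewrite (cong_assoc (fcast _) _ (f ⊠ _)) (IHf pf _ ef) -!cong_assoc fcast_comp.
- move=> i C D f IHf pf X e.
  have ef := nf_psi_free pf fnil.
  rewrite tensor_merge endo_merge cong_id_l cong_assoc rV_nat.
  rewrite -cong_assoc (IHf pf _ ef) -(fcast_fnode ef) tensor_merge endo_merge.
  by rewrite cong_id_l cong_assoc.
- by move=> C D E _; apply: (norm_compat_inv _ (cong_a_aV _ _ _)).
- by move=> C _; apply: (norm_compat_inv _ (cong_l_lV _)).
- by move=> C _; apply: (norm_compat_inv _ (cong_r_rV _)).
Qed.

(** [norm] is invertible, so compatibility determines the tensor of f with the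
    unit, and r is natural. *)
Theorem psi_free_unique A B (f g : term A B) : psi_free f -> psi_free g -> f ≈ g.
Proof.
move=> pf pg.
apply: (comp_cancel_r (cong_r_rV _)); rewrite -!cong_r_nat.
have [k [_ k1 _]] := psi_free_inv (norm_psi_free B fnil).
have -> // : f ⊠ t_id II ≈ g ⊠ t_id II.
apply: (comp_cancel_l k1).
by rewrite -[t_id II]/(t_id (emb fnil)) !(psi_free_norm_compat _ (nf_psi_free pf fnil)).
Qed.

(** * Forests and their sizes *)

Definition flat A := nf A fnil.

Lemma psi_free_flat A B (f : term A B) : psi_free f -> flat A = flat B.
Proof. by move=> pf; apply: nf_psi_free pf fnil. Qed.

Lemma flat_psi_free A B : flat A = flat B -> exists f : term A B, psi_free f.
Proof.
move=> e; have [g [pg _ _]] := psi_free_inv (norm_psi_free B fnil).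
exists (t_r B ∘ (g ∘ (fcast e ∘ (norm A fnil ∘ t_rV A)))).
by rewrite /= pg fcast_psi_free (norm_psi_free A fnil).
Qed.


Fixpoint fcat X Y : forest :=
  match X with
  | fnil => Y
  | fletter p X => fletter p (fcat X Y)
  | fnode i X1 X2 => fnode i X1 (fcat X2 Y)
  end.

Lemma fcatX0 X : fcat X fnil = X.
Proof. by elim: X => //= [p X ->|i X _ Y ->]. Qed.

Lemma fcatA X Y Z : fcat X (fcat Y Z) = fcat (fcat X Y) Z.
Proof. by elim: X => //= [p X ->|i X1 _ X2 ->]. Qed.

Lemma nf_flat A X : nf A X = fcat (flat A) X.
Proof.
rewrite /flat; elim: A X => //= A IHA B IHB X.
by rewrite IHA IHB fcatA -IHA.
Qed.

Lemma flat_tensor A B : flat (A ⊗ B) = fcat (flat A) (flat B).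
Proof. by rewrite {1}/flat /= nf_flat. Qed.

Lemma flat_endo i A : flat (endo i A) = fnode i (flat A) fnil.
Proof. by []. Qed.

Lemma flat_emb X : flat (emb X) = X.
Proof.
rewrite /flat; elim: X => //= [p X ->|i X IHX Y IHY] //.
by rewrite IHX IHY.
Qed.

Fixpoint fsize X : nat :=
  match X with
  | fnil => 0
  | fletter _ X => (fsize X).+1
  | fnode _ X Y => (fsize X + fsize Y).+1
  end.

Fixpoint weight A : nat :=
  match A with
  | letter _ => 1
  | unit_obj => 0
  | A1 ⊗ A2 => weight A1 + weight A2
  | endo _ A1 => (weight A1).+1
  end.

Lemma fsize_cat X Y : fsize (fcat X Y) = fsize X + fsize Y.
Proof. by elim: X => //= [p X ->|i X1 _ X2 ->] //; rewrite addSn addnA. Qed.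

Lemma fsize_flat A : fsize (flat A) = weight A.
Proof.
elim: A => // [A IHA B IHB|i A IHA].
  by rewrite flat_tensor fsize_cat IHA IHB.
by rewrite flat_endo /= IHA addn0.
Qed.

Lemma weight_eq A B (f : term A B) : weight A = weight B.
Proof.
elim: f => //=.
- by move=> ? ? ? _ -> _ ->.
- by move=> ? ? ? ? _ -> _ ->.
- by move=> _ ? ? _ ->.
- by move=> ? ? ?; rewrite addnA.
- by move=> ? ? ?; rewrite addnA.
- by move=> ?; rewrite addn0.
- by move=> ?; rewrite addn0.
Qed.

Lemma fsize0 X : fsize X = 0 -> X = fnil.
Proof. by case: X. Qed.

(** Two factorizations of a list have a common refinement (Levi). *)
Lemma fcat_levi X1 X2 Y1 Y2 : fcat X1 X2 = fcat Y1 Y2 ->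
  (exists Z, X1 = fcat Y1 Z /\ Y2 = fcat Z X2) \/
  (exists Z, Y1 = fcat X1 Z /\ X2 = fcat Z Y2).
Proof.
elim: X1 Y1 => [|p X1 IH|i X _ X1 IH] [|q Y1|j Y Y1] //=.
- by move=> ->; left; exists fnil.
- by move=> ->; right; exists (fletter q Y1).
- by move=> ->; right; exists (fnode j Y Y1).
- by move=> <-; left; exists (fletter p X1).
- by case=> <- /IH[[Z [-> ->]]|[Z [-> ->]]]; [left|right]; exists Z.
- by move=> <-; left; exists (fnode i X X1).
- by case=> <- <- /IH[[Z [-> ->]]|[Z [-> ->]]]; [left|right]; exists Z.
Qed.

Lemma fcat_inj X1 X2 Y1 Y2 : fsize X2 = fsize Y2 ->
  fcat X1 X2 = fcat Y1 Y2 -> X1 = Y1 /\ X2 = Y2.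
Proof.
move=> es /fcat_levi[[Z [e1 e2]]|[Z [e1 e2]]].
- have z0 : Z = fnil.
    apply: fsize0; apply/eqP; move: es; rewrite e2 fsize_cat => /eqP.
    by rewrite -{1}[fsize X2]add0n eqn_add2r eq_sym.
  by rewrite e1 e2 z0 fcatX0.
- have z0 : Z = fnil.
    apply: fsize0; apply/eqP; move: es; rewrite e2 fsize_cat => /eqP.
    by rewrite -{2}[fsize Y2]add0n eqn_add2r.
  by rewrite e1 e2 z0 fcatX0.
Qed.

(** A psi has a functor in its target, and every later arrow keeps it. *)
Lemma psi_free_occ0 A B (f : term A B) : occ B = 0 -> psi_free f.
Proof.
elim: f => //=.
- by move=> C D E g IHg f IHf e; rewrite IHg // IHf // (occ_eq g).
- by move=> C D C' D' g IHg f IHf /eqP; rewrite addn_eq0 => /andP[/eqP/IHg-> /eqP/IHf->].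
Qed.

Lemma flat_nil_occ A : flat A = fnil -> occ A = 0.
Proof.
move=> e; have : weight A = 0 by rewrite -fsize_flat e.
elim: A {e} => //= A IHA B IHB /eqP.
by rewrite addn_eq0 => /andP[/eqP/IHA-> /eqP/IHB->].
Qed.

(** * Splitting an arrow along a tensor in its target *)

Ltac coh := apply: psi_free_unique; rewrite /= ?andbT //.

Definition splits B C D (f : term B (C ⊗ D)) : Prop :=
  exists C' D' (s : term B (C' ⊗ D')) (c : term C' C) (d : term D' D),
    psi_free s /\ f ≈ (c ⊠ d) ∘ s.

Lemma splits_cong B C D (f g : term B (C ⊗ D)) : f ≈ g -> splits g -> splits f.
Proof.
move=> e [C' [D' [s [c [d [ps es]]]]]]; exists C', D', s, c, d; split => //.
by rewrite e.
Qed.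

Lemma splits_tensor B C D C' D' (c : term C' C) (d : term D' D)
    (f : term B (C' ⊗ D')) :
  splits f -> splits ((c ⊠ d) ∘ f).
Proof.
move=> [C'' [D'' [s [c' [d' [ps es]]]]]].
by exists C'', D'', s, (c ∘ c'), (d ∘ d'); rewrite es tensor_merge_comp.
Qed.

Lemma splits_psi_free B C D (f : term B (C ⊗ D)) : psi_free f -> splits f.
Proof.
by move=> pf; exists C, D, f, 𝟏, 𝟏; rewrite cong_tensor_id cong_id_l.
Qed.

(** If C is isomorphic to the unit, all of f goes to the factor D. *)
Lemma splits_nil_l B A C D (f : term B A) (s : term A (C ⊗ D)) :
  psi_free s -> flat C = fnil -> splits (s ∘ f).
Proof.
move=> ps eC.
have [g pg] : exists g : term II C, psi_free g by exact: flat_psi_free.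
have [d pd] : exists d : term A D, psi_free d.
  by apply: flat_psi_free; rewrite (psi_free_flat ps) flat_tensor eC.
have es : s ≈ (g ⊠ d) ∘ t_lV A by coh; rewrite pg.
apply: splits_cong (_ : _ ≈ (g ⊠ d) ∘ ((𝟏 ⊠ f) ∘ t_lV B)) _.
  by rewrite es cong_assoc lV_nat.
do 2!apply: splits_tensor; exact: splits_psi_free.
Qed.

Lemma splits_nil_r B A C D (f : term B A) (s : term A (C ⊗ D)) :
  psi_free s -> flat D = fnil -> splits (s ∘ f).
Proof.
move=> ps eD.
have [g pg] : exists g : term II D, psi_free g by exact: flat_psi_free.
have [c pc] : exists c : term A C, psi_free c.
  by apply: flat_psi_free; rewrite (psi_free_flat ps) flat_tensor eD fcatX0.
have es : s ≈ (c ⊠ g) ∘ t_rV A by coh; rewrite pc.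
apply: splits_cong (_ : _ ≈ (c ⊠ g) ∘ ((f ⊠ 𝟏) ∘ t_rV B)) _.
  by rewrite es cong_assoc rV_nat.
do 2!apply: splits_tensor; exact: splits_psi_free.
Qed.

(** A single tree lies entirely in C or entirely in D. *)
Lemma splits_node B A i X C D (f : term B A) (s : term A (C ⊗ D)) :
  psi_free s -> flat A = fnode i X fnil -> splits (s ∘ f).
Proof.
move=> ps eA; have := psi_free_flat ps; rewrite flat_tensor eA.
case eC: (flat C) => [|p Y|j Y Z] //=; first by move=> _; apply: splits_nil_l.
case=> _ _ e; apply: splits_nil_r => //.
by case: (flat D) e => //; case: Z {eC}.
Qed.

(** For a tensor of two arrows, Levi's lemma says that one of them has a target
    containing the cut; that one is split by induction, and the other is put
    beside the part of it on its own side. *)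
Lemma all_splits B A C D (f : term B A) (s : term A (C ⊗ D)) :
  psi_free s -> splits (s ∘ f).
Proof.
elim: f C D s => /=;
  try by move=> *; apply: splits_psi_free; rewrite /= ?andbT.
- move=> B1 B2 B3 g IHg f IHf C D s /IHg[C' [D' [s' [c [d [ps' es]]]]]].
  apply: splits_cong (_ : _ ≈ (c ⊠ d) ∘ (s' ∘ f)) _.
    by rewrite -!cong_assoc es.
  by apply: splits_tensor; apply: IHf.
- move=> B1 A1 B2 A2 f1 IH1 f2 IH2 C D s ps.
  have := psi_free_flat ps; rewrite !flat_tensor => /fcat_levi.
  case=> [[Z [e1 e2]]|[Z [e1 e2]]].
  + have [s1 p1] : exists s1 : term A1 (C ⊗ emb Z), psi_free s1.
      by apply: flat_psi_free; rewrite flat_tensor flat_emb.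
    have [d0 p0] : exists d : term (emb Z ⊗ A2) D, psi_free d.
      by apply: flat_psi_free; rewrite flat_tensor flat_emb.
    have [C' [D' [s' [c [d [ps' es]]]]]] := IH1 _ _ _ p1.
    apply: splits_cong
      (_ : _ ≈ (𝟏 ⊠ d0) ∘ ((c ⊠ (d ⊠ f2)) ∘ (t_a _ _ _ ∘ (s' ⊠ 𝟏)))) _.
      have -> : s ≈ (𝟏 ⊠ d0) ∘ t_a _ _ _ ∘ (s1 ⊠ 𝟏) by coh; rewrite p0.
      rewrite !cong_assoc tensor_merge es cong_id_l.
      rewrite (comp_reassoc _ (symmetry (cong_a_nat _ _ _))) cong_assoc tensor_merge.
      by rewrite cong_id_r.
    do 2!apply: splits_tensor; apply: splits_psi_free.
    by rewrite /= ps'.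
  + have [s2 p2] : exists s2 : term A2 (emb Z ⊗ D), psi_free s2.
      by apply: flat_psi_free; rewrite flat_tensor flat_emb.
    have [c0 p0] : exists c : term (A1 ⊗ emb Z) C, psi_free c.
      by apply: flat_psi_free; rewrite flat_tensor flat_emb.
    have [C' [D' [s' [c [d [ps' es]]]]]] := IH2 _ _ _ p2.
    apply: splits_cong
      (_ : _ ≈ (c0 ⊠ 𝟏) ∘ (((f1 ⊠ c) ⊠ d) ∘ (t_aV _ _ _ ∘ (𝟏 ⊠ s')))) _.
      have -> : s ≈ (c0 ⊠ 𝟏) ∘ t_aV _ _ _ ∘ (𝟏 ⊠ s2) by coh; rewrite p0.
      rewrite !cong_assoc tensor_merge es cong_id_l.
      rewrite (comp_reassoc _ (symmetry (aV_nat _ _ _))) cong_assoc tensor_merge.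
      by rewrite cong_id_r.
    do 2!apply: splits_tensor; apply: splits_psi_free.
    by rewrite /= ps'.
- move=> i B1 A1 f _ C D s ps; exact: splits_node ps (flat_endo i A1).
- move=> i B1 A1 C D s ps; exact: splits_node ps (flat_endo i _).
Qed.

(** * Factoring an arrow through one absorption *)

(** The functor i absorbs Y and leaves Z. *)
Local Notation shift i X Y Z :=
  ((t_psi i X Y ⊠ t_id Z) ∘ t_aV (endo i X) Y Z).

(** The arrow is, up to a psi-free term, one absorption followed by arrows inside
    and beside the functor. *)
Definition absorbs i B A C (f : term B (endo i A ⊗ C)) : Prop :=
  exists A' L R (s : term B (endo i A' ⊗ (L ⊗ R)))
    (t : term (A' ⊗ L) A) (u : term R C),
    psi_free s /\ f ≈ (t_endo i t ⊠ u) ∘ (shift i A' L R ∘ s).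

Lemma absorbs_cong i B A C (f g : term B (endo i A ⊗ C)) :
  f ≈ g -> absorbs g -> absorbs f.
Proof.
move=> e [A' [L [R [s [t [u [ps es]]]]]]]; exists A', L, R, s, t, u; split => //.
by rewrite e.
Qed.

Lemma absorbs_post i B A C A0 C0 (t0 : term A0 A) (u0 : term C0 C)
    (f : term B (endo i A0 ⊗ C0)) :
  absorbs f -> absorbs ((t_endo i t0 ⊠ u0) ∘ f).
Proof.
move=> [A' [L [R [s [t [u [ps es]]]]]]].
exists A', L, R, s, (t0 ∘ t), (u0 ∘ u); split => //.
by rewrite es tensor_merge_comp endo_merge.
Qed.

Lemma absorbs_pre i B' B A C (f : term B (endo i A ⊗ C)) (g : term B' B) :
  psi_free g -> absorbs f -> absorbs (f ∘ g).
Proof.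
move=> pg [A' [L [R [s [t [u [ps es]]]]]]].
exists A', L, R, (s ∘ g), t, u; split; first by rewrite /= ps.
by rewrite es !cong_assoc.
Qed.

Lemma absorbs_shift i A L R : absorbs (shift i A L R).
Proof.
exists A, L, R, 𝟏, 𝟏, 𝟏; split => //.
by rewrite cong_endo_id cong_tensor_id cong_id_l cong_id_r.
Qed.

(** Here the absorbed object is the unit, and the axiom on psi and r makes its
    absorption trivial. *)
Lemma absorbs_psi_free i B A C (f : term B (endo i A ⊗ C)) :
  psi_free f -> absorbs f.
Proof.
move=> pf; exists A, II, C, ((𝟏 ⊠ t_lV C) ∘ f), (t_r A), 𝟏.
split; first by rewrite /= pf.
rewrite -!cong_assoc tensor_merge cong_psi_r cong_id_l.
rewrite -{1}[f]cong_id_l; apply: cong_comp => //; coh.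
Qed.

(** Absorbing L and then M is absorbing both at once, which is the axiom on psi
    and associativity. *)
Lemma shift_shift i A L M R :
  shift i (A ⊗ L) M R ∘ (shift i A L (M ⊗ R)) ≈
  (t_endo i (t_aV A L M) ⊠ 𝟏) ∘ (shift i A (L ⊗ M) R ∘ (𝟏 ⊠ t_aV L M R)).
Proof.
have e : t_psi i (A ⊗ L) M ∘ (t_psi i A L ⊠ 𝟏) ≈
    t_endo i (t_aV A L M) ∘ (t_psi i A (L ⊗ M) ∘ t_a _ _ _).
  rewrite -cong_psi_a -!cong_assoc endo_merge cong_aV_a cong_endo_id.
  by rewrite cong_id_l.
rewrite !cong_assoc -(cong_tensor_id M R) (comp_reassoc _ (aV_nat _ _ _)).
rewrite cong_assoc !tensor_merge_comp e cong_id_l.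
have -> : (t_endo i (t_aV A L M) ∘ (t_psi i A (L ⊗ M) ∘ t_a _ _ _)) ⊠ t_id R ≈
   (t_endo i (t_aV A L M) ⊠ 𝟏) ∘ ((t_psi i A (L ⊗ M) ⊠ 𝟏) ∘ (t_a _ _ _ ⊠ 𝟏)).
  by rewrite !tensor_merge !cong_id_l.
rewrite !cong_assoc.
rewrite tensor_merge_comp cong_id_l; apply: cong_comp => //; coh.
Qed.

Lemma shift_nat i A L R A' L' R' (t : term A A') (u : term L L') (v : term R R') :
  shift i A' L' R' ∘ (t_endo i t ⊠ (u ⊠ v)) ≈
  (t_endo i (t ⊠ u) ⊠ v) ∘ shift i A L R.
Proof.
rewrite cong_assoc aV_nat -!cong_assoc !tensor_merge cong_psi_nat.
by rewrite cong_id_l cong_id_r.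
Qed.

(** What f absorbed and what the shift adds merge into one absorption.  The
    object L comes from an arrow u whose target is the tensor of L and R, and
    u has to be split to find the part M of the source that is absorbed. *)
Lemma absorbs_shift_comp i B A L R (f : term B (endo i A ⊗ (L ⊗ R))) :
  absorbs f -> absorbs (shift i A L R ∘ f).
Proof.
move=> [A' [L' [R' [s [t [u [ps es]]]]]]].
have [M [R'' [q [m [v [pq eq]]]]]] := all_splits u (isT : psi_free (t_id (L ⊗ R))).
apply: absorbs_cong (_ : _ ≈ (t_endo i (t ⊠ m) ⊠ v) ∘
   ((t_endo i (t_aV _ _ _) ⊠ 𝟏) ∘ (shift i A' (L' ⊗ M) R'' ∘
    ((𝟏 ⊠ t_aV L' M R'') ∘ ((𝟏 ⊠ (𝟏 ⊠ q)) ∘ s))))) _.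
  rewrite es.
  have -> : t_endo i t ⊠ u ≈ (t_endo i t ⊠ (m ⊠ v)) ∘ (𝟏 ⊠ q).
    by rewrite tensor_merge cong_id_r -eq cong_id_l.
  rewrite (cong_assoc (t_endo i t ⊠ (m ⊠ v))) (comp_reassoc _ (shift_nat _ _ _ _)).
  rewrite !cong_assoc; apply: cong_comp => //.
  rewrite -!cong_assoc.
  have h := shift_shift i A' L' M R''.
  rewrite -!cong_assoc in h; rewrite -h !cong_assoc.
  do 2!apply: cong_comp => //.
  rewrite (comp_reassoc _ (tensor_merge _ _ _ _)) cong_id_l cong_id_r.
  have -> : (t_psi i A' L' ⊠ q) ≈ (t_psi i A' L' ⊠ 𝟏) ∘ (𝟏 ⊠ q).
    by rewrite tensor_merge cong_id_l cong_id_r.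
  rewrite cong_assoc; apply: cong_comp => //.
  have := aV_nat (t_id (endo i A')) (t_id L') q; rewrite cong_tensor_id => {}h.
  by rewrite (comp_reassoc _ h) cong_assoc.
do 2!apply: absorbs_post; apply: absorbs_pre (absorbs_shift _ _ _ _).
by rewrite /= pq.
Qed.


Lemma endo_unit_tail i D A C (s : term (endo i D) (endo i A ⊗ C)) :
  psi_free s ->
  exists (x : term D A) (w : term II C), s ≈ (t_endo i x ⊠ w) ∘ t_rV _.
Proof.
move=> ps; have := psi_free_flat ps.
rewrite flat_tensor flat_endo /= => -[/esym eA /esym eC].
have [x px] : exists x : term D A, psi_free x by exact: flat_psi_free.
have [w pw] : exists w : term II C, psi_free w by exact: flat_psi_free.
by exists x, w; coh; rewrite px.
Qed.

(** For a tensor of two arrows the leading tree of the target belongs to the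
    target of the first arrow, unless that target is a unit up to isomorphism,
    and then the first arrow is psi-free. *)
Lemma all_absorbs i B A (X W : fm) (f : term B A) (s : term A (endo i X ⊗ W)) :
  psi_free s -> absorbs (s ∘ f).
Proof.
elim: f X W s => /=;
  try by move=> *; apply: absorbs_psi_free; rewrite /= ?andbT.
- move=> B1 B2 B3 g IHg f IHf X W s /IHg[A' [L [R [s' [t [u [ps' es]]]]]]].
  apply: absorbs_cong (_ : _ ≈ (t_endo i t ⊠ u) ∘ (shift i A' L R ∘ (s' ∘ f))) _.
    by rewrite -cong_assoc es !cong_assoc.
  by apply: absorbs_post; apply: absorbs_shift_comp; apply: IHf.
- move=> B1 A1 B2 A2 f1 IH1 f2 IH2 X W s ps.
  have := psi_free_flat ps; rewrite !flat_tensor flat_endo /=.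
  case e1: (flat A1) => [|//|j Y Z] /=.
  + move=> e2.
    have [s2 p2] : exists s2 : term A2 (endo i X ⊗ W), psi_free s2.
      by apply: flat_psi_free; rewrite flat_tensor.
    have [g pg] : exists g : term A1 II, psi_free g by exact: flat_psi_free.
    have pf := psi_free_occ0 f1 (flat_nil_occ e1).
    apply: absorbs_cong (_ : _ ≈ (s2 ∘ f2) ∘ (t_l _ ∘ ((g ∘ f1) ⊠ 𝟏))) _.
      have -> : s ≈ s2 ∘ (t_l _ ∘ (g ⊠ 𝟏)) by coh; rewrite p2.
      rewrite !cong_assoc tensor_merge cong_id_l; apply: cong_comp => //.
      rewrite -cong_assoc -cong_l_nat cong_assoc tensor_merge cong_id_l.
      by rewrite cong_id_r.
    apply: absorbs_pre; first by rewrite /= pg pf.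
    exact: IH2.
  + case=> ej eY eW; rewrite {}ej in e1.
    have [s1 p1] : exists s1 : term A1 (endo i X ⊗ emb Z), psi_free s1.
      by apply: flat_psi_free; rewrite flat_tensor flat_emb flat_endo e1 eY.
    have [d pd] : exists d : term (emb Z ⊗ A2) W, psi_free d.
      by apply: flat_psi_free; rewrite flat_tensor flat_emb.
    have [A' [L [R [s' [t [u [ps' es]]]]]]] := IH1 _ _ _ p1.
    apply: absorbs_cong (_ : _ ≈ (t_endo i t ⊠ (d ∘ (u ⊠ f2))) ∘
      (shift i A' L (R ⊗ B2) ∘ ((𝟏 ⊠ t_a _ _ _) ∘ t_a _ _ _ ∘ (s' ⊠ 𝟏)))) _.
      have -> : s ≈ (𝟏 ⊠ d) ∘ t_a _ _ _ ∘ (s1 ⊠ 𝟏) by coh; rewrite pd.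
      rewrite !cong_assoc tensor_merge es cong_id_l.
      have -> : (t_endo i t ⊠ u ∘ (shift i A' L R ∘ s')) ⊠ f2 ≈
        (t_endo i t ⊠ u ⊠ f2) ∘ (((t_psi i A' L ⊠ 𝟏) ⊠ 𝟏) ∘
           ((t_aV _ _ _ ∘ s') ⊠ 𝟏)).
        by rewrite !tensor_merge !cong_assoc !cong_id_r.
      rewrite (comp_reassoc _ (cong_a_nat _ _ _)) !cong_assoc.
      rewrite tensor_merge_comp cong_id_l; apply: cong_comp => //.
      rewrite (comp_reassoc _ (cong_a_nat _ _ _)) !cong_assoc cong_tensor_id.
      apply: cong_comp => //.
      by coh; rewrite ps'.
    apply: absorbs_post; apply: absorbs_pre (absorbs_shift _ _ _ _).
    by rewrite /= ps'.
- move=> j B1 A1 f _ X W s ps.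
  have := psi_free_flat ps; rewrite flat_tensor !flat_endo /= => -[ej _ _].
  case: i / ej X s ps => X s ps.
  have [x [w e]] := endo_unit_tail ps.
  apply: absorbs_cong (_ : _ ≈ (t_endo j (x ∘ f) ⊠ w) ∘ t_rV _) _.
    by rewrite e cong_assoc rV_nat tensor_merge_comp endo_merge cong_id_r.
  by apply: absorbs_post; apply: absorbs_psi_free.
- move=> j B1 A1 X W s ps.
  have := psi_free_flat ps; rewrite flat_tensor !flat_endo /= => -[ej _ _].
  case: i / ej X s ps => X s ps.
  have [x [w e]] := endo_unit_tail ps.
  apply: absorbs_cong
    (_ : _ ≈ (t_endo j x ⊠ w) ∘ (shift j B1 A1 II ∘ (𝟏 ⊠ t_rV A1))) _.
    rewrite e !cong_assoc rV_nat; do 2!apply: cong_comp => //; coh.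
  apply: absorbs_post; exact: absorbs_pre (absorbs_shift _ _ _ _).
Qed.

(** * Uniqueness of arrows *)

Lemma emb_unique B X (f g : term B (emb X)) : f ≈ g.
Proof.
elim: X B f g => [|p X IH|i X IHX Y IHY] B f g /=.
- by apply: psi_free_unique; apply: psi_free_occ0.
(* A letter is reached only by psi-free arrows, so the first factor of a
     splitting can be moved into its psi-free part. *)
- have factor (h : term B (letter p ⊗ emb X)) :
      exists D (s : term B (letter p ⊗ D)) (d : term D (emb X)),
        psi_free s /\ h ≈ (𝟏 ⊠ d) ∘ s.
    have [C [D [s [c [d [ps es]]]]]] := all_splits h (isT : psi_free (t_id _)).
    exists D, ((c ⊠ 𝟏) ∘ s), d; split; first by rewrite /= psi_free_occ0 // ps.
    by rewrite tensor_merge_comp cong_id_l cong_id_r -es cong_id_l.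
  have [D [s [d [ps es]]]] := factor f.
  have [D' [s' [d' [ps' es']]]] := factor g.
  have [x px] : exists x : term D D', psi_free x.
    apply: flat_psi_free.
    have := psi_free_flat ps'; rewrite (psi_free_flat ps) !flat_tensor.
    by case.
  have e : s' ≈ (𝟏 ⊠ x) ∘ s by coh; rewrite px.
  by rewrite es es' e tensor_merge_comp cong_id_l (IH _ d (d' ∘ x)).
- have absorbs_id (h : term B (endo i (emb X) ⊗ emb Y)) : absorbs h.
    apply: absorbs_cong (all_absorbs h (isT : psi_free (t_id _))).
    by rewrite cong_id_l.
  have [A [L [R [s [t [u [ps es]]]]]]] := absorbs_id f.
  have [A' [L' [R' [s' [t' [u' [ps' es']]]]]]] := absorbs_id g.
  have := psi_free_flat ps'; rewrite (psi_free_flat ps) !flat_tensor !flat_endo /=.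
  (* Both remainders have the size of Y, since arrows preserve the weight. *)
  case=> eA /fcat_inj[|eL eR].
    by rewrite !fsize_flat (weight_eq u) (weight_eq u').
  have [x px] : exists x : term A A', psi_free x by exact: flat_psi_free.
  have [y py] : exists y : term L L', psi_free y by exact: flat_psi_free.
  have [z pz] : exists z : term R R', psi_free z by exact: flat_psi_free.
  have e : s' ≈ (t_endo i x ⊠ (y ⊠ z)) ∘ s by coh; rewrite px py pz.
  rewrite es es' e (comp_reassoc _ (shift_nat _ _ _ _)) !cong_assoc.
  rewrite (tensor_merge_comp (t_endo i t')) endo_merge.
  by rewrite (IHX _ t (t' ∘ (x ⊠ y))) (IHY _ u (u' ∘ z)).
Qed.

Theorem term_unique A B (f g : term A B) : f ≈ g.
Proof.
have [h ph] : exists h : term B (emb (flat B)), psi_free h.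
  by apply: flat_psi_free; rewrite flat_emb.
have [k [_ kh _]] := psi_free_inv ph.
exact: comp_cancel_l kh (emb_unique _ _).
Qed.

End Coherence.

Theorem mainTheorem2 (P J : Type) :
  [/\ forall (A B : LL P J) (f : hom A B), is_identity (fhom (G P J) f),
      faithful (G P J)
    & preorder (LL P J)].
Proof.
split.
- move=> A B f; exists (occ_eq f); apply/ffunP => k; apply: val_inj.
  by rewrite /= G_term_val ffunE.
- by move=> A B f g _; apply: term_unique.
- by move=> A B f g; apply: term_unique.
Qed.
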